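(* Let $C_0,\overline C\in(0,\infty)$ and $C^*\in(0,2)$, and let $\mathcal F^U$ be the set of distributions $F_Y$ on $[0,1]$ satisfying the regularity conditions (a)–(e) listed in the context with these constants. Let $\mathit{data}_Y=\{Y_i\}_{i=1}^n$ be $n$ i.i.d. draws from $F_Y$, and define $$\mathscr R_n^U(\mathcal F^U)=\inf_{\check p_U}\ \sup_{F_Y\in\mathcal F^U}\Big(R(p_U^*,F_Y)-\mathbb E_{F_Y}\big[R(\check p_U(\mathit{data}_Y),F_Y)\big]\Big),$$ where the infimum is over all data-based uniform pricing strategies, i.e. all rules $\check p_U$ mapping samples $\mathit{data}_Y\in[0,1]^n$ to prices in $[0,1]$. Then $\mathscr R_n^U(\mathcal F^U)=\Omega(n^{-2/3})$.
   Context: $Y\in[0,1]$ has CDF $F_Y$ and density $f_Y$ on $[0,1]$. For a price $p\in[0,1]$, $R(p,F_Y)=p(1-F_Y(p))$, and $p_U^*=p_U^*(F_Y)$ maximizes $R(\cdot,F_Y)$ over $[0,1]$. $\mathbb E_{F_Y}$ is the expectation over $\mathit{data}_Y\sim F_Y$. Regularity conditions on $F_Y$: (a) $|f_Y(y)-f_Y(y')|\le C_0|y-y'|$ for all $y,y'\in[0,1]$. (b) $y\mapsto y(1-F_Y(y))$ is strictly concave with second-order derivative $-2f_Y(y)-yf_Y'(y)\le-C^*$ a.e. (c) $|2f_Y(y)+yf_Y'(y)|\le\overline C$ a.e. (d) $p_U^*(F_Y)\in(0,1)$. (e) $f_Y$ is continuously differentiable in a neighborhood of $p_U^*(F_Y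)$.
   Formalization: The condition on C̄ is strengthened from C̄ > 0 to C̄ > 2: (c) forces f_Y ≤ C̄/2, so for C̄ < 2 the class is empty and for C̄ = 2 it contains at most the uniform law, with zero minimax regret, and the bound fails. *)

(* Defs.v *)
From HB Require Import structures.
From mathcomp Require Import all_boot all_order all_algebra.
From mathcomp Require Import all_classical all_reals all_analysis.

Set Implicit Arguments.
Unset Strict Implicit.
Unset Printing Implicit Defensive.

Import Order.TTheory GRing.Theory Num.Theory.
Import numFieldNormedType.Exports.

Local Open Scope classical_set_scope.
Local Open Scope ring_scope.

Section iid_law.
Context {R : realType}.
Local Notation T := (measurableTypeR R).

Definition tuple_cons n (z : T * n.-tuple T) : n.+1.-tuple T :=
  [tuple of z.1 :: z.2].

Lemma measurable_tuple_cons n : measurable_fun setT (@tuple_cons n).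
Proof. exact: (measurable_cons measurable_fst measurable_snd). Qed.

HB.instance Definition _ n := isMeasurableFun.Build _ _ _ _ (@tuple_cons n)
  (@measurable_tuple_cons n).

(* The n-fold product measure P^n, i.e. the joint law of n i.i.d. draws
   from P, as the image of P \x P^(n-1) under consing. *)
Fixpoint iid_law (P : probability T R) n : probability (n.-tuple T) R :=
  if n is m.+1 then distribution (P \x iid_law P m)%E (@tuple_cons m)
  else dirac [tuple].

End iid_law.

Section uniform_pricing.
Context {R : realType}.
Local Notation T := (measurableTypeR R).
Local Notation mu := (@lebesgue_measure R).

Definition strictly_concave_on (D : set R) (g : R -> R) :=
  forall x y t, D x -> D y -> x != y -> 0 < t < 1 ->
    t * g x + (1 - t) * g y < g (t * x + (1 - t) * y).

(* f is only meaningful on [0, 1]; taking A = setT, the last clause forces P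
   to be supported on [0, 1] and f to integrate to 1 there. *)
Definition has_density01 (P : probability T R) (f : R -> R) :=
  [/\ measurable_fun (`[0, 1] : set T) (f : T -> T),
      forall y, y \in `[0, 1] -> 0 <= f y &
      forall A : set T, measurable A ->
        P A = (\int[mu]_(y in A `&` `[0%R, 1%R]) (f y)%:E)%E].

Definition CDF (P : probability T R) (y : R) : R := fine (P `]-oo, y]%classic).

Definition revenue (P : probability T R) (p : R) : R := p * (1 - CDF P p).

(* The default value 0 is never used for P with a density, since the revenue is
   then continuous on [0, 1]; strict concavity makes the maximizer unique. *)
Definition opt_price (P : probability T R) : R :=
  xget 0 [set p | p \in `[0, 1] /\
                  forall q, q \in `[0, 1] -> revenue P q <= revenue P p].

(* The almost-everywhere conditions are stated on the open interval because
   derive1 f at an endpoint would depend on the values of f outside [0, 1].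
   Since (y^2 f)' = y (2 f + y f'), the upper bound forces f <= Cbar / 2: the
   class is empty for Cbar < 2 and is the uniform law at most for Cbar = 2. *)
Definition regular_class (C0 Cstar Cbar : R) : set (probability T R) :=
  [set P | exists f : R -> R, has_density01 P f /\
    [/\ forall y y', y \in `[0, 1] -> y' \in `[0, 1] ->
          `|f y - f y'| <= C0 * `|y - y'|,
        strictly_concave_on `[0, 1] (revenue P) /\
        {ae mu, forall y, y \in `]0, 1[ ->
          derivable f y 1 /\ - (2 * f y) - y * derive1 f y <= - Cstar},
        {ae mu, forall y, y \in `]0, 1[ ->
          `|2 * f y + y * derive1 f y| <= Cbar},
        opt_price P \in `]0, 1[ &
        \forall y \near opt_price P,
          derivable f y 1 /\ {for y, continuous (derive1 f)}]].

Definition sample_space n : set (n.-tuple T) :=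
  [set s | forall i, tnth s i \in `[0, 1]].

Definition pricing_rules n : set (n.-tuple T -> T) :=
  [set p : n.-tuple T -> T | measurable_fun (@sample_space n) p /\
           forall s, sample_space s -> (p s : R) \in `[0, 1]].

(* The sample space carries all the mass of iid_law P n when P is supported on
   [0, 1], so the integral is the expected revenue of the rule p. *)
Definition regret n (p : n.-tuple T -> T) (P : probability T R) : \bar R :=
  ((revenue P (opt_price P))%:E -
   \int[iid_law P n]_(s in @sample_space n) (revenue P (p s))%:E)%E.

Definition minimax_regret (F : set (probability T R)) n : \bar R :=
  ereal_inf [set ereal_sup [set regret p P | P in F] | p in @pricing_rules n].

End uniform_pricing.

(* Main.v *)
(** Le Cam's two-point method with h = n^(-1/3). Both laws have CDF
    F(y) = y + eps * h^2 * hump((y - (1 + h)/2) / h) on [0, 1], where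
    hump(u) = max(0, 1 - u^2)^3: with eps = 0 the uniform law, whose optimal
    price is 1/2, and with a fixed small eps > 0. The perturbation changes the
    density by O(eps * h) and its derivative by O(eps), so both laws are
    regular, and it moves the optimal price by at least a multiple of eps * h.
    As the revenue curves have curvature of order 1, a price at distance more
    than eps * h / 32 from 1/2 loses (eps * h / 32)^2 under the uniform law,
    and any other price loses as much under the perturbed one. The chi-square
    divergence between the laws is at most h^3 = 1/n, so n draws cannot tell
    them apart and one of the two regrets is of order h^2 = n^(-2/3). *)
Require Import Defs.
From HB Require Import structures.
From mathcomp Require Import all_boot all_order all_algebra.
From mathcomp Require Import all_classical all_reals all_analysis.
From mathcomp Require Import measurable_realfun ring lra.

Set Implicit Arguments.
Unset Strict Implicit.
Unset Printing Implicit Defensive.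

Import Order.TTheory GRing.Theory Num.Theory.
Import numFieldNormedType.Exports.

Local Open Scope classical_set_scope.
Local Open Scope ring_scope.

(** * Probability laws on [0, 1] given by a density *)

Section density01.
Context {R : realType}.
Local Notation T := (measurableTypeR R).
Local Notation mu := (@lebesgue_measure R).
Local Notation I01 := (`[0%R, 1%R]%classic : set T).

Lemma itv01P (y : R) : (y \in `[0, 1]) = (0 <= y <= 1).
Proof. by rewrite in_itv. Qed.

Section existence.
Variable f : R -> R.
Hypothesis f_cont : continuous f.
Hypothesis f_ge0 : forall y, y \in `[0, 1] -> 0 <= f y.
Hypothesis int_f : (\int[mu]_(y in I01) (f y)%:E = 1)%E.

Let fm : measurable_fun setT (f : T -> T).
Proof. exact: continuous_measurable_fun. Qed.

Let g : T -> \bar R := (EFin \o f) \_ I01.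

Let mg : measurable_fun setT g.
Proof.
apply/(measurable_restrictT _ _).1 => //.
by apply/measurable_EFinP; exact: measurable_funTS.
Qed.

Let g_ge0 y : (0 <= g y)%E.
Proof.
rewrite /g patchE; case: ifPn => // /[!inE] /= y01.
by rewrite lee_fin f_ge0.
Qed.

Definition density01_measure (A : set T) : \bar R := (\int[mu]_(y in A) g y)%E.

Let m0 : density01_measure set0 = 0%E.
Proof. by rewrite /density01_measure integral_set0. Qed.

Let m_ge0 A : (0 <= density01_measure A)%E.
Proof. exact: integral_ge0. Qed.

Let m_sigma : semi_sigma_additive density01_measure.
Proof. exact: semi_sigma_additive_nng_induced. Qed.

HB.instance Definition _ := isMeasure.Build _ _ _ density01_measure
  m0 m_ge0 m_sigma.

Let mT : density01_measure setT = 1%E.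
Proof. by rewrite /density01_measure -integral_mkcond. Qed.

HB.instance Definition _ := @Measure_isProbability.Build _ _ R
  density01_measure mT.

Lemma exists_density01 : exists P : probability T R, has_density01 P f.
Proof.
exists density01_measure; split => //; first exact: measurable_funTS.
by move=> A mA; rewrite integral_mkcondr.
Qed.

End existence.

Variables (P : probability T R) (f : R -> R).
Hypothesis dP : has_density01 P f.

Lemma density01_itv : P I01 = 1%E.
Proof.
have [_ _ dE] := dP.
have := probability_setT P; rewrite (dE _ measurableT) setTI => <-.
have mI : measurable I01 by [].
by rewrite (dE _ mI) setIid.
Qed.

(** The law is absolutely continuous, and its Radon-Nikodym derivative agrees almost everywhere with
    [f] extended by 0 outside [0, 1], since both have the same integral over every measurable
    set. *)
Lemma integral_density01 (g : T -> \bar R) :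
  measurable_fun setT g -> (forall x, 0 <= g x)%E ->
  (\int[P]_x g x = \int[mu]_(x in I01) (g x * (f x)%:E))%E.
Proof.
move=> mg g0; have [mf f0 dE] := dP.
have Pmu : P `<< mu.
  apply/null_content_dominatesP => A mA A0; rewrite dE//.
  apply: null_set_integral => //; first exact: measurableI.
    by apply/measurable_EFinP; apply: measurable_funS mf => // ? [].
  by apply: subset_measure0 A0 => //; exact: measurableI.
pose k := (EFin \o f) \_ I01.
have mk : measurable_fun setT k.
  apply/(measurable_restrictT _ _).1 => //.
  exact/measurable_EFinP.
have dk : ae_eq mu setT (Radon_Nikodym_SigmaFinite.f P mu) k.
  apply: integral_ae_eq => //.
    exact: Radon_Nikodym_SigmaFinite.f_integrable.
  move=> E _ mE.
  transitivity (P E); last by rewrite dE// integral_mkcondr.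
  exact/esym/Radon_Nikodym_SigmaFinite.f_integral.
rewrite -(Radon_Nikodym_SigmaFinite.change_of_variables Pmu g0)//.
rewrite [RHS]integral_mkcond; apply: ge0_ae_eq_integral => //.
- apply: emeasurable_funM => //; apply: measurable_int.
  exact: Radon_Nikodym_SigmaFinite.f_integrable.
- apply/(measurable_restrictT _ _).1 => //.
  apply: emeasurable_funM; first exact: measurable_funTS.
  exact/measurable_EFinP.
- by move=> x _; rewrite mule_ge0// Radon_Nikodym_SigmaFinite.f_ge0.
- move=> x _; rewrite patchE; case: ifPn => // /[!inE] /= x01.
  by rewrite mule_ge0// lee_fin f0.
apply: filterS dk => x /= + _ => -> //.
by rewrite /k !patchE; case: ifPn => //; rewrite mule0.
Qed.

End density01.

(** * Product laws and the chi-square comparison *)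

Section iid.
Context {R : realType}.
Local Notation T := (measurableTypeR R).
Local Notation mu := (@lebesgue_measure R).
Local Notation I01 := (`[0%R, 1%R]%classic : set T).

Lemma measurable_sample_space n :
  measurable (@sample_space R n : set (n.-tuple T)).
Proof.
have -> : @sample_space R n =
    \bigcap_(i in [set: 'I_n]) ((fun s : n.-tuple T => tnth s i) @^-1` I01).
  by apply/seteqP; split => s /= hs i; [move=> _|]; exact: hs.
apply: fin_bigcap_measurable => // i _.
rewrite -[X in measurable X]setTI.
exact: measurable_tnth.
Qed.

Lemma iid_law_sample_space (P : probability T R) n : P I01 = 1%E ->
  iid_law P n (@sample_space R n) = 1%E.
Proof.
move=> P1; elim: n => [|n IH] /=.
  by rewrite diracE mem_set// => -[].
rewrite /distribution /pushforward.
have -> : @tuple_cons R n @^-1` @sample_space R n.+1 = I01 `*` @sample_space R n.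
  apply/seteqP; split => [[x s]|[x s]] /=.
    move=> h; split; first by have := h ord0; rewrite tnth0.
    by move=> i; have := h (lift ord0 i); rewrite tnthS.
  by move=> [x01 h] i; case: (unliftP ord0 i) => [j|] ->; rewrite ?tnthS ?tnth0//; exact: h.
rewrite product_measure1E//; last exact: measurable_sample_space.
by rewrite [X in (X * _)%E]P1 [X in (_ * X)%E]IH mule1.
Qed.

(** Conditioning on the first draw: by definition the product measure integrates the sections of a
    set over its first coordinate. *)
Lemma iid_lawS (P : probability T R) n (A : set (n.+1.-tuple T)) :
  iid_law P n.+1 A =
  (\int[P]_x iid_law P n (xsection (@tuple_cons R n @^-1` A) x))%E.
Proof. by []. Qed.

(* In the induction step the bound is used with t / f x, where x is the first
   observation: it then tensorizes without introducing the density of P1^n. *)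
Lemma iid_law_le_chi2 (P0 P1 : probability T R) (f : R -> R) (M : R) :
  has_density01 P0 (cst 1) -> has_density01 P1 f ->
  (forall y, y \in `[0, 1] -> 0 < f y) -> 0 <= M ->
  (\int[mu]_(y in I01) (f y ^+ 2)%:E <= M%:E)%E ->
  forall n (A : set (n.-tuple T)) (t : R), measurable A -> 0 < t ->
  (iid_law P1 n A <=
    (t / 2)%:E * iid_law P0 n A + (M ^+ n / (2 * t))%:E)%E.
Proof.
move=> d0 d1 f0 M0 fM; elim => [|n IH] A t mA t0.
  (* Without draws both masses are 1 or both are 0; for 1 the bound is the AM-GM inequality t/2 +
     1/(2t) >= 1. *)
  rewrite /= !diracE; case: (_ \in A); rewrite /= -?EFinM -?EFinD lee_fin.
    rewrite mulr1 expr0 -subr_ge0.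
    have -> : t / 2 + 1 / (2 * t) - 1 = (t - 1) ^+ 2 / (2 * t).
      by field; rewrite gt_eqF.
    by rewrite divr_ge0 ?sqr_ge0// mulr_ge0// ltW.
  by rewrite mulr0 add0r expr0 divr_ge0// mulr_ge0// ltW.
set A' := @tuple_cons R n @^-1` A.
have mA' : measurable A'.
  by rewrite -[A']setTI; exact: measurable_tuple_cons.
have mf : measurable_fun I01 (f : T -> T) by have [] := d1.
rewrite !iid_lawS -/A'.
have mx (P : probability T R) :
    measurable_fun setT (fun x => iid_law P n (xsection A' x)).
  exact: measurable_fun_xsection.
rewrite (integral_density01 d0)// (integral_density01 d1)//.
apply: (@le_trans _ _ (\int[mu]_(x in I01)
   ((t / 2)%:E * (iid_law P0 n (xsection A' x) * 1%:E) +
    (M ^+ n / (2 * t))%:E * (f x ^+ 2)%:E))%E).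
  apply: ge0_le_integral => //.
  - by move=> x /= x01; rewrite mule_ge0// lee_fin ltW// f0.
  - apply: emeasurable_funM; first exact: measurable_funTS.
    exact/measurable_EFinP.
  - apply: emeasurable_funD; apply: emeasurable_funM => //.
      by apply: emeasurable_funM => //; exact: measurable_funTS.
    by apply/measurable_EFinP; exact: measurable_funX.
  - move=> x /= x01; have fx := f0 _ x01.
    have mAx : measurable (xsection A' x) by exact: measurable_xsection.
    have tf : 0 < t / f x by rewrite divr_gt0.
    apply: (@le_trans _ _ (((t / f x / 2)%:E * iid_law P0 n (xsection A' x)
       + (M ^+ n / (2 * (t / f x)))%:E) * (f x)%:E)%E).
      by rewrite lee_wpmul2r ?IH// lee_fin ltW.
    rewrite -(fineK (fin_num_measure (iid_law P0 n) _ mAx)).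
    rewrite -!EFinM -!EFinD lee_fin le_eqVlt; apply/orP; left.
    by apply/eqP; field; rewrite !gt_eqF.
rewrite ge0_integralD//; last 4 first.
- by move=> x _; rewrite mule1 mule_ge0// lee_fin divr_ge0// ltW.
- apply: emeasurable_funM => //; apply: emeasurable_funM => //.
  exact: measurable_funTS.
- move=> x _; rewrite -EFinM lee_fin mulr_ge0 ?sqr_ge0//.
  by rewrite divr_ge0 ?exprn_ge0// mulr_ge0// ltW.
- apply: emeasurable_funM => //.
  by apply/measurable_EFinP; exact: measurable_funX.
rewrite ge0_integralZl//; last 3 first.
- by apply: emeasurable_funM => //; exact: measurable_funTS.
- by move=> x _; rewrite mule1.
- by rewrite lee_fin divr_ge0// ltW.
rewrite leeD2l// ge0_integralZl//; last 3 first.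
- by apply/measurable_EFinP; exact: measurable_funX.
- by move=> x _; rewrite lee_fin sqr_ge0.
- by rewrite lee_fin divr_ge0 ?exprn_ge0// mulr_ge0// ltW.
(* The integral of [f] squared is at most [M], which turns M^n into M^(n+1). *)
rewrite exprSr (mulrAC _ M) [leRHS]EFinM lee_wpmul2l// lee_fin.
by rewrite divr_ge0 ?exprn_ge0// mulr_ge0// ltW.
Qed.

End iid.

(** * The bump and its first two derivatives *)

Section hump.
Context {R : realType}.
Implicit Types (x y z u v : R).

(** The quadratic error puts the difference quotient within C|h| of [l]. At the kink of a positive
    part such a bound follows from sign cases, without one-sided derivatives. *)
Lemma is_derive_quadratic (f : R -> R) x l C :
  (forall y, `|f y - f x - l * (y - x)| <= C * (y - x) ^+ 2) ->
  is_derive x 1 f l.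
Proof.
move=> fC.
have C1 : 0 < `|C| + 1 by rewrite ltr_wpDl.
suff L : h^-1 *: ((f \o shift x) (h *: (1 : R)) - f x) @[h --> 0^'] --> l.
  by split; [apply/cvg_ex; exists l|exact: cvg_lim].
apply/cvgrPdist_le => e e0; near=> h.
have h0 : h != 0 by near: h; exact: nbhs_dnbhs_neq.
rewrite /= [_ *: 1]mulr1 [_ *: _]mulrC.
have -> : l - (f (h + x) - f x) / h =
    - ((f (h + x) - f x - l * (h + x - x)) / h) by field.
rewrite normrN normrM normfV ler_pdivrMr ?normr_gt0//.
apply: le_trans (fC _) _; rewrite addrK -real_normK ?num_real// expr2 mulrA.
rewrite ler_wpM2r//; apply: (@le_trans _ _ ((`|C| + 1) * `|h|)).
  by rewrite ler_wpM2r// (le_trans (ler_norm _))// lerDl.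
rewrite -ler_pdivlMl// ltW//.
have : `|h| < (`|C| + 1)^-1 * e.
  near: h; apply: dnbhs0_lt; rewrite mulr_gt0// invr_gt0//.
by [].
Unshelve. all: by end_near. Qed.

Definition pos_part x : R := Num.max 0 x.

Lemma pos_partP x :
  (pos_part x = 0 /\ x <= 0) \/ (pos_part x = x /\ 0 <= x).
Proof. by rewrite /pos_part; case: (leP 0 x) => h; [right|left; rewrite ltW]. Qed.

Lemma is_derive_pos_part2 x :
  is_derive x 1 (fun z => pos_part z ^+ 2) (2 * pos_part x).
Proof.
apply: (@is_derive_quadratic _ _ _ 1) => y; rewrite ler_norml.
have xy2 := sqr_ge0 (y - x); have x2 := sqr_ge0 x; have y2 := sqr_ge0 y.
case: (pos_partP x) => -[-> hx]; case: (pos_partP y) => -[-> hy].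
- by apply/andP; split; lra.
- by have xy := mulr_le0_ge0 hx hy; apply/andP; split; lra.
- by have xy := mulr_ge0_le0 hx hy; apply/andP; split; lra.
- by apply/andP; split; lra.
Qed.

Lemma is_derive_pos_part3 x :
  is_derive x 1 (fun z => pos_part z ^+ 3) (3 * pos_part x ^+ 2).
Proof.
(* Peeling off the factor z leaves the square, so the product rule never meets [pos_part] itself,
   which has no derivative at 0. *)
have -> : (fun z => pos_part z ^+ 3) = id * (fun z => pos_part z ^+ 2).
  apply/funext => z; rewrite mulrfctE.
  by case: (pos_partP z) => -[-> _]; ring.
apply: is_derive_eq; first exact: (is_deriveM _ (is_derive_pos_part2 x)).
by rewrite /GRing.scale/=; case: (pos_partP x) => -[-> _]; ring.
Qed.

(** The cube is the least integer power whose second derivative is continuous at the edges u = 1 and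
    u = -1; [dhump] and [ddhump] are the first two derivatives. *)
Definition hump u := pos_part (1 - u ^+ 2) ^+ 3.
Definition dhump u := - (6 * u) * pos_part (1 - u ^+ 2) ^+ 2.
Definition ddhump u :=
  24 * u ^+ 2 * pos_part (1 - u ^+ 2) - 6 * pos_part (1 - u ^+ 2) ^+ 2.

Let is_derive_1sqr u : is_derive u 1 (fun z : R => 1 - z ^+ 2) (- (2 * u)).
Proof.
apply: is_derive_eq.
by rewrite /GRing.scale/=; ring.
Qed.

Lemma is_derive_hump u : is_derive u 1 hump (dhump u).
Proof.
apply: is_derive_eq.
  exact: (@is_derive1_comp _ (fun z => pos_part z ^+ 3) _ _ _ _
    (is_derive_pos_part3 _) (is_derive_1sqr u)).
by rewrite /dhump; ring.
Qed.

Lemma is_derive_dhump u : is_derive u 1 dhump (ddhump u).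
Proof.
have d2 := @is_derive1_comp _ (fun z => pos_part z ^+ 2) _ _ _ _
  (is_derive_pos_part2 _) (is_derive_1sqr u).
have d1 : is_derive u 1 (fun z : R => - (6 * z)) (- 6).
  by apply: is_derive_eq; rewrite /GRing.scale/=; ring.
rewrite (_ : dhump = (fun z => - (6 * z)) *
    ((fun z => pos_part z ^+ 2) \o (fun z : R => 1 - z ^+ 2)))//.
apply: (is_derive_eq (is_deriveM d1 d2)).
by rewrite /GRing.scale/= /ddhump; ring.
Qed.

Lemma continuous_pos_part : continuous pos_part.
Proof.
move=> x; apply: (@continuous_max _ _ (cst 0) id); [exact: cvg_cst|exact: cvg_id].
Qed.

Lemma continuous_ddhump : continuous ddhump.
Proof.
have cp : continuous (fun u : R => pos_part (1 - u ^+ 2)).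
  move=> u; apply: (@continuous_comp _ _ _ (fun u : R => 1 - u ^+ 2) pos_part).
    by apply: cvgB; [exact: cvg_cst|exact: exprn_continuous].
  exact: continuous_pos_part.
move=> u; apply: cvgB; apply: cvgM; try exact: cp.
- by apply: cvgM; [exact: cvg_cst|exact: exprn_continuous].
- exact: cvg_cst.
- exact: (continuous_comp (cp u) (@exprn_continuous _ 2 _)).
Qed.

Lemma hump_bounds u : 0 <= hump u <= 1.
Proof.
rewrite /hump; case: (pos_partP (1 - u ^+ 2)) => -[-> h]; first by lra.
rewrite exprn_ge0//= exprn_ile1//.
by rewrite lerBlDr lerDl sqr_ge0.
Qed.

Lemma dhump_bound u : `|dhump u| <= 6.
Proof.
rewrite /dhump ler_norml; case: (pos_partP (1 - u ^+ 2)) => -[-> h]; first by lra.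
have u1 : `|u| <= 1.
  by rewrite -(@expr_le1 _ 2)// real_normK ?num_real// -subr_ge0.
have m1 : `|(1 - u ^+ 2) ^+ 2| <= 1.
  by rewrite normrX expr_le1// ger0_norm// lerBlDr lerDl sqr_ge0.
rewrite -ler_norml normrM normrN normrM (ger0_norm (ler0n _ 6)) -mulrA.
by rewrite ler_piMr// mulr_ile1.
Qed.

Lemma ddhump_bound u : `|ddhump u| <= 6.
Proof.
rewrite /ddhump ler_norml.
case: (pos_partP (1 - u ^+ 2)) => -[-> h]; first by lra.
have : 0 <= u ^+ 2 by exact: sqr_ge0.
move: (u ^+ 2) h => s h s0.
(* In s = u^2 the value is 24/5 - 30 (s - 3/5)^2; the bound from below uses s (1 - s) >= 0. *)
have := mulr_ge0 s0 h; have := sqr_ge0 (s - 3 / 5).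
by move=> ? ?; apply/andP; split; lra.
Qed.

Lemma hump_out u : 1 <= `|u| -> hump u = 0 /\ dhump u = 0.
Proof.
move=> u1; have h : 1 - u ^+ 2 <= 0.
  rewrite subr_le0 -real_normK ?num_real//.
  by rewrite -(expr1n _ 2) lerXn2r ?nnegrE.
have m0 : pos_part (1 - u ^+ 2) = 0 by rewrite /pos_part max_l.
by rewrite /hump /dhump m0 !expr0n/= mulr0.
Qed.

(** The window surrounds u = -1/2, the rescaled position of the price 1/2. In the factored
    difference of cubes the factors besides v - u are at least 7/8 and 14/10, with product above 1;
    here 175/256 = 1 - (9/16)^2. *)
Lemma hump_growth u v : - (9 / 16) <= u -> u <= v -> v <= - (7 / 16) ->
  v - u <= hump v - hump u.
Proof.
move=> u1 uv v1; rewrite /hump.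
have a0 : 175 / 256 <= 1 - v ^+ 2 by nra.
have b0 : 175 / 256 <= 1 - u ^+ 2 by nra.
have pE z : 175 / 256 <= z -> pos_part z = z by move=> hz; rewrite /pos_part max_r//; lra.
rewrite !pE//.
have -> : (1 - v ^+ 2) ^+ 3 - (1 - u ^+ 2) ^+ 3 = (v - u) *
   (- (u + v) * ((1 - v ^+ 2) ^+ 2 + (1 - v ^+ 2) * (1 - u ^+ 2) + (1 - u ^+ 2) ^+ 2)).
  by ring.
rewrite ler_peMr ?subr_ge0//.
have : 14 / 10 <= (1 - v ^+ 2) ^+ 2 + (1 - v ^+ 2) * (1 - u ^+ 2) + (1 - u ^+ 2) ^+ 2.
  by nra.
have : 7 / 8 <= - (u + v) by lra.
move: (_ + _ + _) (- (u + v)) => p q hq hp; nra.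
Qed.

End hump.

(** * Laws with a twice differentiable CDF *)

Section smooth_cdf.
Context {R : realType}.
Local Notation T := (measurableTypeR R).
Local Notation mu := (@lebesgue_measure R).
Local Notation I01 := (`[0%R, 1%R]%classic : set T).

Lemma is_derive_continuous (g dg : R -> R) :
  (forall x : R, is_derive x 1 g (dg x)) -> continuous g.
Proof.
move=> dgP x; apply: differentiable_continuous; apply/derivable1_diffP.
by have [] := dgP x.
Qed.

Lemma MVT_is_derive (g dg : R -> R) (a b : R) :
  (forall x : R, is_derive x 1 g (dg x)) -> a < b ->
  exists c, a < c < b /\ g b - g a = dg c * (b - a).
Proof.
move=> dgP ab; have cg := is_derive_continuous dgP.
have [c] := MVT ab (fun x _ => dgP x) (continuous_subspaceT cg).
by rewrite in_itv/= => cab E; exists c.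
Qed.

Lemma integral_is_derive (g dg : R -> R) (a b : R) :
  (forall x : R, is_derive x 1 g (dg x)) -> continuous dg -> a <= b ->
  (\int[mu]_(x in `[a, b]) (dg x)%:E = (g b - g a)%:E)%E.
Proof.
move=> dgP cdg; have cg := is_derive_continuous dgP.
rewrite le_eqVlt => /predU1P[->|ab].
  by rewrite set_itv1 integral_set1 subrr.
rewrite (@continuous_FTC2 _ _ g)//.
- exact: continuous_subspaceT.
- split; first by move=> x _; have [] := dgP x.
  + by apply: cvg_at_right_filter; exact: cg.
  + by apply: cvg_at_left_filter; exact: cg.
- by move=> x _; rewrite derive1E; apply: derive_val.
Qed.

Variables (F f df : R -> R).
Hypothesis F_f : forall x : R, is_derive x 1 F (f x).
Hypothesis f_df : forall x : R, is_derive x 1 f (df x).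
Hypothesis df_cont : continuous df.
Hypothesis f_gt0 : forall y, y \in `[0, 1] -> 0 < f y.
Hypotheses (F0 : F 0 = 0) (F1 : F 1 = 1).

Let f_cont : continuous f. Proof. exact: is_derive_continuous f_df. Qed.

Lemma exists_smooth_cdf : exists P : probability T R, has_density01 P f.
Proof.
apply: exists_density01 => //; first by move=> y /f_gt0 /ltW.
by rewrite (integral_is_derive F_f)// F1 F0 subr0.
Qed.

Variable P : probability T R.
Hypothesis dP : has_density01 P f.

Lemma smooth_CDFE y : y \in `[0, 1] -> CDF P y = F y.
Proof.
rewrite in_itv/= => /andP[y0 y1]; have [_ _ dE] := dP.
rewrite /CDF dE//.
have -> : `]-oo, y]%classic `&` `[0%R, 1%R]%classic = `[0%R, y]%classic :> set R.
  apply/seteqP; split => x /=; rewrite !in_itv/=; lra.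
by rewrite (integral_is_derive F_f)// F0 subr0.
Qed.

(** Built from [F] instead of the measure: it is differentiable on the whole line and agrees with
    [revenue P] on [0, 1]. *)
Definition smooth_revenue (y : R) := y * (1 - F y).

Lemma smooth_revenueE y : y \in `[0, 1] -> revenue P y = smooth_revenue y.
Proof. by move=> y01; rewrite /revenue smooth_CDFE. Qed.

Let dr y := 1 - F y - y * f y.

Lemma is_derive_smooth_revenue (y : R) : is_derive y 1 smooth_revenue (dr y).
Proof.
have dF := F_f y.
have d1 : is_derive y 1 (cst 1 - F) (- f y).
  by apply: is_derive_eq; rewrite sub0r.
apply: (is_derive_eq (is_deriveM (is_derive_id y 1) d1)).
by rewrite /GRing.scale/= !fctE/= /dr; ring.
Qed.

Let is_derive_dr (y : R) : is_derive y 1 dr (- (2 * f y) - y * df y).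
Proof.
have dF := F_f y; have dd := f_df y.
have d1 : is_derive y 1 (id * f) (f y + y * df y).
  apply: (is_derive_eq (is_deriveM (is_derive_id y 1) dd)).
  by rewrite /GRing.scale/=; ring.
have d2 : is_derive y 1 (cst 1 - F) (- f y).
  by apply: is_derive_eq; rewrite sub0r.
apply: (is_derive_eq (is_deriveB d2 d1)).
by ring.
Qed.

Lemma continuous_smooth_revenue : continuous smooth_revenue.
Proof. exact: is_derive_continuous is_derive_smooth_revenue. Qed.

(** Continuity on a compact interval gives a maximizer, so the choice in [opt_price] does not fall
    back on its default value. *)
Lemma opt_priceP : opt_price P \in `[0, 1] /\
  forall q, q \in `[0, 1] -> revenue P q <= revenue P (opt_price P).
Proof.
apply: (@xgetPex _ 0 [set p | p \in `[0, 1] /\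
  forall q, q \in `[0, 1] -> revenue P q <= revenue P p]).
have [p p01 pmax] := EVT_max ler01
  (continuous_subspaceT continuous_smooth_revenue).
by exists p; split => // q q01; rewrite !smooth_revenueE// pmax.
Qed.

(** The revenue vanishes at 0 and at 1, but is positive at 1/2 because a positive density forces
    F(1/2) < 1. *)
Lemma opt_price_interior : opt_price P \in `]0, 1[.
Proof.
have [] := opt_priceP.
have h01 : (2^-1 : R) \in `[0, 1] by rewrite in_itv/=; lra.
set p := opt_price P => p01 /(_ _ h01); rewrite !smooth_revenueE//.
have h1 : 2^-1 < 1 :> R by lra.
have [c [c01]] := MVT_is_derive F_f h1; rewrite F1 => E.
have fc : 0 < f c by apply: f_gt0; rewrite in_itv/=; lra.
have r2 : 0 < smooth_revenue 2^-1.
  rewrite /smooth_revenue mulr_gt0 ?invr_gt0//.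
  by rewrite E mulr_gt0//; lra.
move: p01; rewrite !in_itv/= => /andP[].
rewrite le_eqVlt => /predU1P[<-|p0].
  by rewrite {2}/smooth_revenue mul0r => _ /(lt_le_trans r2); rewrite ltxx.
rewrite le_eqVlt => /predU1P[->|p1 _]; last by rewrite p0.
by rewrite {2}/smooth_revenue F1 subrr mulr0 => /(lt_le_trans r2); rewrite (ltxx 0).
Qed.

(** The quantity 2 f + y df is minus the second derivative of the revenue, so its bounds give both
    curvature conditions at every point. They also make [dr] strictly decreasing on [0, 1], whence
    strict concavity. *)
Lemma smooth_regular_class (C0 Cstar Cbar : R) :
  0 < Cstar -> (forall y, `|df y| <= C0) ->
  (forall y, y \in `[0, 1] -> Cstar <= 2 * f y + y * df y <= Cbar) ->
  regular_class C0 Cstar Cbar P.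
Proof.
move=> Cs0 dfC C2.
have df1 (y : R) : derivable f y 1 by have [] := f_df y.
have df1E y : derive1 f y = df y.
  by rewrite derive1E; apply: derive_val.
have o01 (y : R) : y \in `]0, 1[ -> y \in `[0, 1].
  by rewrite !in_itv/= => /andP[/ltW-> /ltW->].
exists f; split => //; split.
- move=> y y' _ _; wlog yy : y y' / y < y'.
    move=> H; have [/H//|/H|->] := ltgtP y y'.
      by rewrite distrC (distrC y).
    by rewrite !subrr normr0 mulr0.
  have [c [_ E]] := MVT_is_derive f_df yy.
  by rewrite distrC E normrM (distrC y) ler_wpM2r.
- split; last first.
    apply: aeW => /= y y01; split => //.
    by rewrite df1E; have /andP[] := C2 _ (o01 _ y01); lra.
  move=> x y t; rewrite /= => x01 y01 xy t01.
  have m01 : t * x + (1 - t) * y \in `[0, 1].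
    move: x01 y01; rewrite !in_itv/= => x01 y01.
    by apply/andP; split; nra.
  rewrite !smooth_revenueE//.
  (* The claim is symmetric under exchanging x with y and t with 1 - t. *)
  wlog xy' : x y t x01 y01 xy t01 m01 / x < y.
    move=> H; move: (xy); rewrite neq_lt => /orP[|yx]; first exact: H.
    have tE : t = 1 - (1 - t) by ring.
    rewrite addrC [X in _ < _ X]addrC {2 4}tE; apply: H => //.
    + by rewrite eq_sym.
    + lra.
    + by rewrite -tE addrC.
  set z := t * x + (1 - t) * y in m01 *.
  have xz : x < z by rewrite /z; nra.
  have zy : z < y by rewrite /z; nra.
  have [c [cxz Ec]] := MVT_is_derive is_derive_smooth_revenue xz.
  have [d [dzy Ed]] := MVT_is_derive is_derive_smooth_revenue zy.
  have cd : c < d by lra.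
  have [e [ecd Ee]] := MVT_is_derive is_derive_dr cd.
  have e01 : e \in `[0, 1] by move: x01 y01; rewrite !in_itv/=; lra.
  have /andP[e1 _] := C2 _ e01.
  have drdc : dr d < dr c.
    rewrite -subr_lt0 Ee nmulr_rlt0 ?subr_gt0//; lra.
  (* The concavity gap at z becomes t (1 - t) (y - x) (dr c - dr d) with c < z < d. *)
  have zx : z - x = (1 - t) * (y - x) by rewrite /z; ring.
  have yz : y - z = t * (y - x) by rewrite /z; ring.
  rewrite -subr_gt0.
  have -> : smooth_revenue z -
      (t * smooth_revenue x + (1 - t) * smooth_revenue y) =
    t * (smooth_revenue z - smooth_revenue x) -
    (1 - t) * (smooth_revenue y - smooth_revenue z) by ring.
  rewrite Ec Ed zx yz.
  have -> : t * (dr c * ((1 - t) * (y - x))) -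
     (1 - t) * (dr d * (t * (y - x))) = t * (1 - t) * (y - x) * (dr c - dr d).
    by ring.
  by rewrite !mulr_gt0 ?subr_gt0//; case/andP: t01.
- apply: aeW => /= y y01; have /andP[c1 c2] := C2 _ (o01 _ y01).
  by rewrite df1E ger0_norm// (le_trans _ c1)// ltW.
- exact: opt_price_interior.
- near=> y; split => //.
  rewrite (_ : derive1 f = df); first exact: df_cont.
  by apply/funext => x; exact: df1E.
Unshelve. all: by end_near.
Qed.

End smooth_cdf.

(** * The uniform law with a bump added to its CDF *)

Section perturbed_uniform.
Context {R : realType}.
Local Notation T := (measurableTypeR R).
Local Notation mu := (@lebesgue_measure R).
Local Notation I01 := (`[0%R, 1%R]%classic : set T).
Variables eps h : R.

(* The bump is centred so that it is increasing, with slope of order 1 in the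
   rescaled variable, at the price 1/2 which is optimal for the uniform law. *)
Let z (y : R) := (y - (1 + h) / 2) / h.

Definition pert_cdf (y : R) := y + eps * h ^+ 2 * hump (z y).
Definition pert_pdf (y : R) := 1 + eps * h * dhump (z y).
Definition pert_dpdf (y : R) := eps * ddhump (z y).

Hypothesis h_gt0 : 0 < h.

Let is_derive_z (y : R) : is_derive y 1 z h^-1.
Proof.
rewrite (_ : z = h^-1 *: (id - cst ((1 + h) / 2))); last first.
  by apply/funext => x; rewrite /z !fctE mulrC.
apply: is_derive_eq.
by rewrite subr0 /GRing.scale/= mulr1.
Qed.

Lemma is_derive_pert_cdf (y : R) : is_derive y 1 pert_cdf (pert_pdf y).
Proof.
have d1 := @is_derive1_comp _ _ _ _ _ _ (is_derive_hump (z y)) (is_derive_z y).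
have d2 := is_deriveZ (eps * h ^+ 2) d1.
apply: (is_derive_eq (is_deriveD (is_derive_id y 1) d2)).
by rewrite /GRing.scale/= /pert_pdf; field; rewrite gt_eqF.
Qed.

Lemma is_derive_pert_pdf (y : R) : is_derive y 1 pert_pdf (pert_dpdf y).
Proof.
have d1 := @is_derive1_comp _ _ _ _ _ _ (is_derive_dhump (z y)) (is_derive_z y).
have d2 := is_deriveZ (eps * h) d1.
have d0 : is_derive y 1 (cst 1 : R -> R) 0 by exact: is_derive_cst.
apply: (is_derive_eq (is_deriveD d0 d2)).
by rewrite /GRing.scale/= /pert_dpdf; field; rewrite gt_eqF.
Qed.

Lemma continuous_pert_dpdf : continuous pert_dpdf.
Proof.
move=> y; apply: cvgM; first exact: cvg_cst.
have cz := is_derive_continuous is_derive_z.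
exact: (continuous_comp (cz y) (@continuous_ddhump R _)).
Qed.

Hypotheses (eps_ge0 : 0 <= eps) (eps_le : eps <= 1 / 16) (h_le : h <= 1 / 3).

Let z_out (y : R) : h <= `|y - (1 + h) / 2| -> 1 <= `|z y|.
Proof. by move=> hy; rewrite normrM normfV (gtr0_norm h_gt0) ler_pdivlMr ?mul1r. Qed.

(** The bump lives on [(1 - h)/2, (1 + 3h)/2], which [h_le] keeps inside [0, 1]; hence the end
    values are those of the uniform law. *)
Lemma pert_cdf0 : pert_cdf 0 = 0.
Proof.
rewrite /pert_cdf (hump_out _).1 ?mulr0 ?addr0//.
have [h0 hl] := (h_gt0, h_le).
by apply: z_out; rewrite distrC subr0 ger0_norm; lra.
Qed.

Lemma pert_cdf1 : pert_cdf 1 = 1.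
Proof.
rewrite /pert_cdf (hump_out _).1 ?mulr0 ?addr0//.
have [h0 hl] := (h_gt0, h_le).
by apply: z_out; rewrite ger0_norm; lra.
Qed.

Let eh0 : 0 <= eps * h. Proof. by rewrite mulr_ge0// ltW. Qed.
Let eh1 : eps * h <= eps / 3. Proof. by rewrite ler_wpM2l// -[leRHS]mul1r. Qed.

Lemma pert_pdf_bound (y : R) : `|pert_pdf y - 1| <= 6 * (eps * h).
Proof.
rewrite /pert_pdf addrC addKr normrM (ger0_norm eh0) mulrC.
by rewrite ler_wpM2r// dhump_bound.
Qed.

Lemma pert_dpdf_bound (y : R) : `|pert_dpdf y| <= 6 * eps.
Proof.
rewrite /pert_dpdf normrM (ger0_norm eps_ge0) mulrC.
by rewrite ler_wpM2r// ddhump_bound.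
Qed.

Lemma pert_pdf_gt0 (y : R) : 0 < pert_pdf y.
Proof.
have [e1 e2] := (eh1, eps_le).
by have := pert_pdf_bound y; rewrite ler_norml => /andP[]; lra.
Qed.

(** The uniform law gives exactly 2. The deviation is at most 12 eps h + 6 eps, and h <= 1/3 makes
    this at most 10 eps. *)
Lemma pert_second_derivative (y : R) : y \in `[0, 1] ->
  `|2 * pert_pdf y + y * pert_dpdf y - 2| <= 10 * eps.
Proof.
rewrite in_itv/= => /andP[y0 y1]; have e1 := eh1.
have -> : 2 * pert_pdf y + y * pert_dpdf y - 2 =
  2 * (pert_pdf y - 1) + y * pert_dpdf y by ring.
rewrite (le_trans (ler_normD _ _))// (normrM y) (normrM 2) (ger0_norm y0) ger0_norm//.
have df6 : y * `|pert_dpdf y| <= `|pert_dpdf y| by rewrite ler_piMl.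
have := pert_pdf_bound y; have := pert_dpdf_bound y; lra.
Qed.

(** The excess over 1 is the chi-square divergence, the integral of (f - 1)^2. It lives on an
    interval of length 2h where the integrand is at most (6 eps h)^2, so it is at most 72 eps^2 h^3,
    and 72 eps^2 <= 1. *)
Lemma integral_pert_pdf_sqr :
  (\int[mu]_(y in I01) (pert_pdf y ^+ 2)%:E <= (1 + h ^+ 3)%:E)%E.
Proof.
have [h0 hl] := (h_gt0, h_le).
pose S : set T := `[(1 - h) / 2, (1 + 3 * h) / 2]%classic.
have cf := is_derive_continuous is_derive_pert_pdf.
have mf : measurable_fun setT (pert_pdf : T -> T) by exact: continuous_measurable_fun.
have m01 : mu I01 = 1%E.
  by rewrite lebesgue_measure_itv/= lte_fin ltr01 oppr0 adde0.
have i1 : (\int[mu]_(y in I01) (pert_pdf y)%:E = 1)%E.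
  by rewrite (integral_is_derive is_derive_pert_cdf)// pert_cdf0 pert_cdf1 subr0.
have mfI : measurable_fun I01 (pert_pdf : T -> T) by exact: measurable_funTS.
have mS : measurable S by exact: measurable_itv.
have f_ge0 y : 0 <= pert_pdf y by rewrite ltW// pert_pdf_gt0.
set B := (6 * (eps * h)) ^+ 2.
have B_ge0 : 0 <= B by exact: sqr_ge0.
(* Adding 1 to both sides allows f^2 + 1 = 2 f + (f - 1)^2, in which every integrand is
   nonnegative. *)
rewrite EFinD -(leeD2rE _ _ (isT : 1%E \is a fin_num)).
have -> : (\int[mu]_(y in I01) (pert_pdf y ^+ 2)%:E + 1 =
    \int[mu]_(y in I01) ((pert_pdf y ^+ 2)%:E + cst 1%E y))%E.
  rewrite ge0_integralD//.
  - by rewrite integral_cst// [X in (_ * X)%E]m01 mule1.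
  - by move=> y _; rewrite lee_fin sqr_ge0.
  - by apply/measurable_EFinP; exact: measurable_funX.
apply: (@le_trans _ _ (\int[mu]_(y in I01)
    (2%:E * (pert_pdf y)%:E + B%:E * (\1_S y)%:E))%E).
  apply: ge0_le_integral => //.
  - by move=> y _; rewrite -EFinD lee_fin addr_ge0 ?sqr_ge0.
  - apply: emeasurable_funD => //.
    by apply/measurable_EFinP; exact: measurable_funX.
  - apply: emeasurable_funD; apply: emeasurable_funM => //; apply/measurable_EFinP => //.
  - move=> y _; rewrite -EFinD -!EFinM -EFinD lee_fin.
    have -> : pert_pdf y ^+ 2 + 1 = 2 * pert_pdf y + (pert_pdf y - 1) ^+ 2 by ring.
    rewrite lerD2l indicE; case: (boolP (y \in S)) => yS.
      rewrite mulr1 -real_normK ?num_real// lerXn2r ?nnegrE ?mulr_ge0 ?(ltW h0)//.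
      exact: pert_pdf_bound.
    rewrite mulr0 /pert_pdf (hump_out _).2 ?mulr0 ?addr0 ?subrr ?expr0n//.
    apply: z_out; move: yS; rewrite notin_setE /S/= in_itv/= => /negP.
    rewrite negb_and -!ltNge => /orP[] hy.
      by rewrite ltr0_norm; lra.
    by rewrite gtr0_norm; lra.
rewrite ge0_integralD//; last 4 first.
- by move=> y _; rewrite mule_ge0 ?lee_fin.
- by apply: emeasurable_funM => //; exact/measurable_EFinP.
- by move=> y _; rewrite mule_ge0 ?lee_fin.
- by apply: emeasurable_funM => //; exact/measurable_EFinP.
rewrite ge0_integralZl//; last 2 first.
- exact/measurable_EFinP.
- by move=> y _; rewrite lee_fin.
rewrite i1 mule1 ge0_integralZl//; last first.
  exact/measurable_EFinP.
rewrite integral_indic//.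
apply: (@le_trans _ _ (2%:E + B%:E * (2 * h)%:E)%E).
  rewrite leeD2l// lee_wpmul2l ?lee_fin//.
  apply: (@le_trans _ _ (mu S)); first by apply: le_measure; rewrite ?inE//; exact: measurableI.
  rewrite lebesgue_measure_itv/= lte_fin.
  by case: ifPn => _; rewrite -?EFinB lee_fin; lra.
rewrite -EFinM -!EFinD lee_fin /B.
have : 0 <= h ^+ 3 by rewrite exprn_ge0// ltW.
have -> : (6 * (eps * h)) ^+ 2 * (2 * h) = 72 * eps ^+ 2 * h ^+ 3 by ring.
have : 72 * eps ^+ 2 <= 1 by have [e0 e1] := (eps_ge0, eps_le); nra.
move: (h ^+ 3) (72 * _) => a b b1 a0; nra.
Qed.

Definition sep_width : R := eps * h / 32.
(** A competitor for the perturbed law rather than its optimum. It lies two widths left of 1/2,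
    hence at least one width away from every price within [sep_width] of 1/2. *)
Definition sep_price : R := 1 / 2 - eps * h / 16.

Lemma sep_price01 : sep_price \in `[0, 1].
Proof.
have [e0 e1 e2] := And3 eh0 eh1 eps_le.
by rewrite /sep_price in_itv/=; apply/andP; split; lra.
Qed.

(** Write e = eps h and q for [sep_price]. Moving from p to q costs at most e^2/256 in the uniform
    part x (1 - x), while the lower CDF at q gains at least p (L - K) >= e^2/128. The net gain
    e^2/256 exceeds (e/32)^2. *)
Lemma pert_separation (p : R) : `|p - 1 / 2| <= sep_width ->
  smooth_revenue pert_cdf p + sep_width ^+ 2 <=
  smooth_revenue pert_cdf sep_price.
Proof.
have [e0 e1 e2] := And3 eh0 eh1 eps_le.
have h0 := h_gt0; rewrite /sep_width ler_norml => /andP[p1 p2].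
have zE x : z x = (x - 1 / 2) / h - 1 / 2 by rewrite /z; field; rewrite gt_eqF.
have dz : z p - z sep_price = (p - sep_price) / h.
  by rewrite /z; field; rewrite gt_eqF.
(* Both prices are within eps/16 of -1/2 in the rescaled variable, inside the window of
   [hump_growth]. *)
have zq : - (9 / 16) <= z sep_price.
  rewrite zE lerBrDr ler_pdivlMr// /sep_price; nra.
have zp : z p <= - (7 / 16).
  rewrite zE lerBlDr ler_pdivrMr//; nra.
have qp : eps * h / 32 <= p - sep_price by rewrite /sep_price; lra.
have zqp : z sep_price <= z p.
  by rewrite -subr_ge0 dz divr_ge0 ?(ltW h_gt0)//; lra.
have := hump_growth zq zqp zp; rewrite dz => gr.
have /andP[bq0 _] := hump_bounds (z sep_price).
set K := eps * h ^+ 2 * hump (z sep_price).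
set L := eps * h ^+ 2 * hump (z p).
have K0 : 0 <= K by rewrite mulr_ge0// mulr_ge0// sqr_ge0.
have KL : eps * h * (p - sep_price) <= L - K.
  have -> : eps * h * (p - sep_price) = eps * h ^+ 2 * ((p - sep_price) / h).
    by field; rewrite gt_eqF.
  by rewrite -mulrBr ler_wpM2l// mulr_ge0// sqr_ge0.
have KL2 : (eps * h) * (eps * h) / 32 <= L - K.
  apply: le_trans KL; rewrite -mulrA ler_wpM2l//.
have p4 : 1 / 4 <= p by lra.
rewrite /smooth_revenue /pert_cdf -/K -/L.
rewrite /sep_price in qp *.
move: (eps * h) e0 e1 p1 p2 KL2 qp => e e0 e1 p1 p2 KL2 qp.
have h1 : 1 / 4 * (e * e / 32) <= p * (L - K).
  by apply: ler_pM => //; rewrite ?mulr_ge0//; lra.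
have h2 : 0 <= (p - (1 / 2 - e / 16)) * K by rewrite mulr_ge0//; lra.
have h3 : 0 <= (p - 1 / 2) ^+ 2 by exact: sqr_ge0.
nra.
Qed.

End perturbed_uniform.

(** * Losses under the uniform law, and the passage from loss to regret *)

Lemma uniform_separation {R : realType} (eps h p : R) :
  0 <= eps -> 0 < h -> sep_width eps h < `|p - 1 / 2| ->
  smooth_revenue (pert_cdf 0 h) p + sep_width eps h ^+ 2 <=
  smooth_revenue (pert_cdf 0 h) (1 / 2).
Proof.
move=> e0 h0 hp.
(* The revenue is now 1/4 - (p - 1/2)^2, so the loss is the squared distance to 1/2. *)
rewrite /smooth_revenue /pert_cdf !mul0r !addr0.
have : sep_width eps h ^+ 2 <= (p - 1 / 2) ^+ 2.
  rewrite -[leRHS]real_normK ?num_real// lerXn2r ?nnegrE ?(ltW hp)//.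
  by rewrite /sep_width divr_ge0// mulr_ge0// ltW.
move: (sep_width eps h ^+ 2) => s; lra.
Qed.

(** The revenue of the rule plus [d] on [A] never exceeds the optimal revenue, as [q] is better by
    [d] on [A]; integrate. The continuous [r] makes the revenue along the rule measurable. *)
Lemma regret_ge {R : realType} (P : probability (measurableTypeR R) R)
    (r : R -> R) n (p : n.-tuple (measurableTypeR R) -> measurableTypeR R)
    (A : set (n.-tuple (measurableTypeR R))) (q d : R) :
  continuous r ->
  (forall y, y \in `[0, 1] -> 0 <= r y /\ revenue P y = r y) ->
  (opt_price P \in `[0, 1] /\
    forall q, q \in `[0, 1] -> revenue P q <= revenue P (opt_price P)) ->
  pricing_rules p -> q \in `[0, 1] ->
  measurable A -> A `<=` @sample_space R n -> 0 <= d ->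
  (forall s, A s -> r (p s) + d <= r q) ->
  (d%:E * iid_law P n A <= regret p P)%E.
Proof.
move=> cr rE [p01_opt opt_max] [mp p01] q01 mA AS d0 Ad.
set S := @sample_space R n in mp AS *.
have mS : measurable S by exact: measurable_sample_space.
set nu := iid_law P n.
set rs := revenue P (opt_price P).
have r_le y : y \in `[0, 1] -> r y <= rs.
  by move=> y01; rewrite -(rE _ y01).2 opt_max.
have rs0 : 0 <= rs by rewrite (le_trans _ (r_le _ q01))// (rE _ q01).1.
have mrp : measurable_fun S (fun s => r (p s)).
  apply: (@measurableT_comp _ _ _ _ _ _ (r : measurableTypeR R -> measurableTypeR R)) => //.
  exact: continuous_measurable_fun.
have rp0 s : S s -> 0 <= r (p s) by move=> /p01 /rE[].
have E1 : (\int[nu]_(s in S) (revenue P (p s))%:E =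
           \int[nu]_(s in S) (r (p s))%:E)%E.
  by apply: eq_integral => s /[!inE] /p01 ps; rewrite (rE _ ps).2.
have mA1 : measurable_fun S (fun s => d%:E * (\1_A s)%:E)%E.
  apply: emeasurable_funM => //; apply/measurable_EFinP.
  exact: measurable_indic.
(* Kept as a sum: the subtraction in [regret] is made once the integral is known to be finite. *)
have E2 : (\int[nu]_(s in S) (r (p s))%:E + d%:E * nu A <= rs%:E)%E.
  have -> : (d%:E * nu A = \int[nu]_(s in S) (d%:E * (\1_A s)%:E))%E.
    rewrite ge0_integralZl//.
    - by rewrite integral_indic// (setIidl AS).
    - by apply/measurable_EFinP; exact: measurable_indic.
  rewrite -ge0_integralD//; last 2 first.
  - exact/measurable_EFinP.
  - by move=> s Ss; rewrite -EFinM lee_fin mulr_ge0.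
  apply: (@le_trans _ _ (\int[nu]_(s in S) rs%:E)%E).
    apply: ge0_le_integral => //.
    - by move=> s Ss; rewrite -EFinM -EFinD lee_fin addr_ge0 ?rp0// mulr_ge0.
    - by apply: emeasurable_funD => //; exact/measurable_EFinP.
    - move=> s Ss; rewrite -EFinM -EFinD lee_fin indicE.
      case: (boolP (s \in A)) => [/[!inE] As|_].
        by rewrite mulr1 (le_trans (Ad _ As))// r_le.
      by rewrite mulr0 addr0 r_le//; exact: p01.
  rewrite integral_cst// -[leRHS]mule1 lee_wpmul2l ?lee_fin//.
  exact: probability_le1.
rewrite /regret -/nu -/rs E1.
have i0 : (0 <= \int[nu]_(s in S) (r (p s))%:E)%E.
  by apply: integral_ge0 => s Ss; rewrite lee_fin rp0.
have fi : (\int[nu]_(s in S) (r (p s))%:E)%E \is a fin_num.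
  rewrite ge0_fin_numE// (le_lt_trans _ (ltry rs))// (le_trans _ E2)//.
  by rewrite leeDl// mule_ge0.
by rewrite leeBrDl// addeC.
Qed.

(** * The two-point argument *)

Section two_points.
Context {R : realType}.
Local Notation T := (measurableTypeR R).
Variables (C0 Cstar Cbar : R).
Hypothesis Cstar_gt0 : 0 < Cstar.

(** The last three bounds on [eps] secure, in order, the Lipschitz constant of the density and the
    lower and upper curvature bounds. *)
Lemma exists_perturbed_law (eps h : R) :
  0 < h -> h <= 1 / 3 -> 0 <= eps -> eps <= 1 / 16 ->
  6 * eps <= C0 -> 10 * eps <= 2 - Cstar -> 10 * eps <= Cbar - 2 ->
  exists P : probability T R,
    has_density01 P (pert_pdf eps h) /\ regular_class C0 Cstar Cbar P.
Proof.
move=> h0 h1 e0 e1 eC0 eCs eCb.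
have dF := is_derive_pert_cdf eps h0.
have df := is_derive_pert_pdf eps h0.
have f_gt0 y : y \in `[0, 1] -> 0 < pert_pdf eps h y.
  by move=> _; exact: pert_pdf_gt0.
have F0 := pert_cdf0 eps h0 h1.
have F1 := pert_cdf1 eps h0 h1.
have [P dP] := exists_smooth_cdf dF df f_gt0 F0 F1.
exists P; split => //.
apply: (smooth_regular_class dF df _ f_gt0 F0 F1 dP) => //.
- exact: continuous_pert_dpdf.
- by move=> y; apply: le_trans eC0; exact: pert_dpdf_bound.
move=> y y01; have := pert_second_derivative h0 e0 h1 y01.
by rewrite ler_norml => /andP[? ?]; apply/andP; split; lra.
Qed.

Lemma perturbed_regret_ge (eps h : R) (P : probability T R) n
    (p : n.-tuple T -> T) (A : set (n.-tuple T)) (q d : R) :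
  0 < h -> h <= 1 / 3 -> 0 <= eps -> eps <= 1 / 16 ->
  has_density01 P (pert_pdf eps h) ->
  pricing_rules p -> q \in `[0, 1] ->
  measurable A -> A `<=` @sample_space R n -> 0 <= d ->
  (forall s, A s -> smooth_revenue (pert_cdf eps h) (p s) + d
     <= smooth_revenue (pert_cdf eps h) q) ->
  (d%:E * iid_law P n A <= regret p P)%E.
Proof.
move=> h0 h1 e0 e1 dP.
have dF := is_derive_pert_cdf eps h0.
have df := is_derive_pert_pdf eps h0.
have F0 := pert_cdf0 eps h0 h1.
have F1 := pert_cdf1 eps h0 h1.
apply: regret_ge.
- exact: continuous_smooth_revenue dF.
- move=> y y01; have rE := smooth_revenueE dF df F0 dP y01; split => //.
  rewrite -rE /revenue mulr_ge0//; first by move: y01; rewrite itv01P => /andP[].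
  rewrite subr_ge0 -lee_fin fineK ?fin_num_measure//.
  exact: probability_le1.
- exact: (opt_priceP dF df F0 dP).
Qed.

(** Let [A] be the event that the rule prices farther than [w] from 1/2. It costs w^2 under the
    uniform law, its complement costs w^2 under the perturbed one, and the two probabilities cannot
    both be small. *)
Lemma minimax_two_points (eps h : R) n : (0 < n)%N ->
  0 < h -> h <= 1 / 3 -> h ^+ 3 = n%:R^-1 -> 0 <= eps -> eps <= 1 / 16 ->
  6 * eps <= C0 -> 10 * eps <= 2 - Cstar -> 10 * eps <= Cbar - 2 ->
  ((sep_width eps h ^+ 2 / (2 * expR 1))%:E <=
    minimax_regret (regular_class C0 Cstar Cbar) n)%E.
Proof.
move=> n0 h0 h1 h3 e0 e1 eC0 eCs eCb.
have [P1 [d1 c1]] := exists_perturbed_law h0 h1 e0 e1 eC0 eCs eCb.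
have [P0 [d0 c0]] : exists P : probability T R,
    has_density01 P (pert_pdf 0 h) /\ regular_class C0 Cstar Cbar P.
  by apply: exists_perturbed_law => //; lra.
have pdf0 : pert_pdf 0 h = cst 1.
  by apply/funext => y; rewrite /pert_pdf !mul0r addr0.
set w := sep_width eps h.
apply: le_ereal_inf_tmp => _ [p pP <-].
set S := @sample_space R n.
have mS : measurable S by exact: measurable_sample_space.
have [mp p01] := pP.
pose A := S `&` [set s | w < `|p s - 1 / 2|].
have mA : measurable A.
  have mg : measurable_fun S (fun s => `|p s - 1 / 2| : T).
    by apply: measurableT_comp => //; exact: measurable_funB.
  have -> : A = S `&` (fun s => `|p s - 1 / 2| : T) @^-1` `]w, +oo[.
    by apply/seteqP; split => s [Ss /= hs]; split => //=; move: hs;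
      rewrite in_itv/= andbT.
  exact: mg.
have w2 : 0 <= w ^+ 2 by exact: sqr_ge0.
have r0 : ((w ^+ 2)%:E * iid_law P0 n A <= regret p P0)%E.
  apply: (@perturbed_regret_ge 0 h _ _ _ _ (1 / 2)) => //.
  - by rewrite in_itv/=; lra.
  - by move=> s [].
  - by move=> s [_ /= hs]; exact: uniform_separation.
have r1 : ((w ^+ 2)%:E * iid_law P1 n (S `\` A) <= regret p P1)%E.
  apply: (@perturbed_regret_ge eps h _ _ _ _ (sep_price eps h)) => //.
  - exact: sep_price01.
  - exact: measurableD.
  - move=> s [Ss nA]; apply: pert_separation => //.
    by rewrite leNgt; apply/negP => hs; apply: nA.
set E : R := expR 1.
have E2 : 2 <= E by rewrite /E; have := expR_ge1Dx (1 : R); lra.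
have M0 : 0 <= 1 + h ^+ 3 :> R by rewrite addr_ge0// exprn_ge0// ltW.
(* This is (1 + 1/n)^n <= e. *)
have ME : (1 + h ^+ 3) ^+ n <= E.
  apply: (@le_trans _ _ (expR (h ^+ 3) ^+ n)).
    by rewrite lerXn2r ?nnegrE ?expR_ge0// expR_ge1Dx.
  by rewrite -expRM_natl h3 mulfV// pnatr_eq0 -lt0n.
(* With t = [E] the constant term M^n / (2E) is at most 1/2. *)
have chi : (iid_law P1 n A <= (E / 2)%:E * iid_law P0 n A + (1 / 2)%:E)%E.
  have := @iid_law_le_chi2 R P0 P1 (pert_pdf eps h) (1 + h ^+ 3).
  rewrite -pdf0 => /(_ d0 d1).
  move=> /(_ (fun y _ => pert_pdf_gt0 h0 e0 e1 h1 y) M0).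
  move=> /(_ (integral_pert_pdf_sqr h0 e0 e1 h1) n A E mA).
  have E0 : 0 < E by lra.
  move=> /(_ E0) /le_trans; apply; rewrite leeD2l// lee_fin.
  by rewrite ler_pdivrMr ?mulr_gt0// mulrA divfK// mul1r.
set a0 := iid_law P0 n A in r0 chi.
set a1 := iid_law P1 n A in chi.
have a1E : iid_law P1 n (S `\` A) = (1 - a1)%E.
  have SE : iid_law P1 n S = 1%E by rewrite iid_law_sample_space// (density01_itv d1).
  rewrite measureD//; last by rewrite [ltLHS]SE ltry.
  rewrite [X in (X - _)%E]SE (_ : S `&` A = A)//.
  by rewrite setIA setIid.
have a0f : a0 \is a fin_num by exact: fin_num_measure.
have a1f : a1 \is a fin_num by exact: fin_num_measure.
have sup_ge P : regular_class C0 Cstar Cbar P ->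
    (regret p P <= ereal_sup [set regret p P | P in regular_class C0 Cstar Cbar])%E.
  by move=> cP; apply: ereal_sup_ubound; exists P.
rewrite a1E in r1.
move: r0 r1 chi; rewrite -(fineK a0f) -(fineK a1f) -EFinB -!EFinM -!EFinD lee_fin.
move: (fine a0) (fine a1) => b0 b1 r0 r1 chi.
(* Either P0 gives [A] mass at least 1/(2E), or P1 gives it less than 3/4, which leaves at least 1/4
   >= 1/(2E) for the complement. *)
have [hb|hb] := lerP (1 / (2 * E)) b0.
  apply: le_trans (sup_ge _ c0); apply: le_trans r0.
  rewrite lee_fin ler_wpM2l//.
  by rewrite -[leLHS]mul1r.
apply: le_trans (sup_ge _ c1); apply: le_trans r1.
have E0 : 0 < E by lra.
have hb' : E / 2 * b0 < 1 / 4.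
  move: hb; rewrite ltr_pdivlMr ?mulr_gt0//; lra.
rewrite lee_fin ler_wpM2l//.
apply: (@le_trans _ _ (1 / 4)); last lra.
rewrite -[leLHS]mul1r ler_pdivrMr ?mulr_gt0//; lra.
Qed.

End two_points.

(** * Choice of [eps] and [h], and the rate *)

Theorem theorem5 (R : realType) (C0 Cstar Cbar : R) (C0_gt0 : 0 < C0)
    (Cstar_gt0 : 0 < Cstar) (Cstar_lt2 : Cstar < 2) (Cbar_gt2 : 2 < Cbar) :
  exists2 c : R, 0 < c &
    \forall n \near \oo,
      ((c * n%:R `^ (- (2 / 3)))%:E
         <= minimax_regret (regular_class C0 Cstar Cbar) n)%E.
Proof.
(* The largest [eps] meeting all four upper bounds; it does not depend on n. *)
pose eps := Num.min (1 / 16) (Num.min (C0 / 6)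
  (Num.min ((2 - Cstar) / 10) ((Cbar - 2) / 10))).
have eps_gt0 : 0 < eps by rewrite /eps !lt_min; apply/and4P; split; lra.
have : eps <= eps by [].
rewrite {2}/eps !le_min => /and4P[e1 e2 e3 e4].
(* From (eps h / 32)^2 / (2e), with 2 times 32^2 equal to 2^11 and h^2 = n^(-2/3). *)
exists (eps ^+ 2 / (2 ^+ 11 * expR 1)).
  by rewrite divr_gt0 ?exprn_gt0// mulr_gt0 ?exprn_gt0 ?expR_gt0.
near=> n.
(* Exactly what h = n^(-1/3) <= 1/3 asks for. *)
have n27 : (27 <= n)%N by near: n; exact: nbhs_infty_ge.
have n0 : (0 < n)%N by apply: leq_trans n27.
have nR0 : 0 < n%:R :> R by rewrite ltr0n.
pose h : R := n%:R `^ (- (1 / 3)).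
have h0 : 0 < h by exact: powR_gt0.
have h3 : h ^+ 3 = n%:R^-1.
  rewrite -powR_mulrn ?powR_ge0// /h -powRrM.
  rewrite (_ : - (1 / 3) * 3%:R = - 1); last by field.
  by rewrite powRN powRr1// ltW.
have h2 : n%:R `^ (- (2 / 3)) = h ^+ 2.
  rewrite -powR_mulrn ?powR_ge0// /h -powRrM.
  by congr (_ `^ _); field.
have h1 : h <= 1 / 3.
  rewrite -(ler_pXn2r (isT : (0 < 3)%N)) ?nnegrE ?(ltW h0) ?divr_ge0//.
  rewrite h3 expr_div_n expr1n -natrX mul1r lef_pV2 ?posrE ?ltr0n//.
  by rewrite ler_nat.
have -> : eps ^+ 2 / (2 ^+ 11 * expR 1) * n%:R `^ (- (2 / 3)) =
    sep_width eps h ^+ 2 / (2 * expR 1).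
  by rewrite h2 /sep_width; field; rewrite gt_eqF// expR_gt0.
by apply: minimax_two_points => //; [exact: ltW|lra..].
Unshelve. all: by end_near. Qed.
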